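(* Let $t>2$ be an integer, let $q\in\mathbb{C}$ be a primitive $t$-th root of unity, and let $\varphi$ be a $\frac12$-derivation of the $q$-quantum torus Lie algebra $L(q)$. Then there exist $a,c\in\mathbb{C}$ such that for all $\mathbf m\in\Gamma$ $$\varphi(x^{\mathbf m})=a\,x^{\mathbf m},\qquad \varphi(D(\mathbf m))=\begin{cases}c\,x^{\mathbf m}+a\,D(\mathbf m), & \text{if }\mathbf m\in\Gamma_1,\\ a\,D(\mathbf m), & \text{if }\mathbf m\in\Gamma_2.\end{cases}$$
   Context: Write $(t\mathbb{Z})^2=t\mathbb{Z}\times t\mathbb{Z}\subset\mathbb{Z}^2$, $\Gamma_1=(t\mathbb{Z})^2\setminus\{\mathbf 0\}$, $\Gamma_2=\mathbb{Z}^2\setminus(t\mathbb{Z})^2$, $\Gamma=\Gamma_1\cup\Gamma_2=\mathbb{Z}^2\setminus\{\mathbf 0\}$. For $\mathbf m=(m_1,m_2)$, $\mathbf n=(n_1,n_2)$ put $\lambda(\mathbf m,\mathbf n)=q^{m_2n_1}-q^{m_1n_2}$ and $\det\binom{\mathbf n}{\mathbf m}=m_2n_1-m_1n_2$. The $q$-quantum torus Lie algebra $L(q)$ is the complex Lie algebra with basis $\{x^{\mathbf m},D(\mathbf m)\mid\mathbf m\in\Gamma\}$ and anticommutative bracket given, for $\mathbf m,\mathbf n\in\Gamma$, by $[x^{\mathbf m},x^{\mathbf n}]=\lambda(\mathbf m,\mathbf n)x^{\mathbf m+\mathbf n}$, $[D(\mathbf m),x^{\mathbf n}]=h(\mathbf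 m,\mathbf n)x^{\mathbf m+\mathbf n}$, $[D(\mathbf m),D(\mathbf n)]=g(\mathbf m,\mathbf n)D(\mathbf m+\mathbf n)$, where $h(\mathbf m,\mathbf n)=\det\binom{\mathbf n}{\mathbf m}$ if $\mathbf m\in\Gamma_1$ and $h(\mathbf m,\mathbf n)=\lambda(\mathbf m,\mathbf n)$ if $\mathbf m\in\Gamma_2$; $g(\mathbf m,\mathbf n)=\lambda(\mathbf m,\mathbf n)$ if $\mathbf m,\mathbf n\in\Gamma_2$ and $g(\mathbf m,\mathbf n)=\det\binom{\mathbf n}{\mathbf m}$ otherwise; with the conventions that the symbols $x^{\mathbf 0}$ and $D(\mathbf 0)$ denote $0$. A linear map $\varphi:L\to L$ on a Lie algebra $L$ is a $\frac12$-derivation if $\varphi([x,y])=\frac12\left([\varphi(x),y]+[x,\varphi(y)]\right)$ for all $x,y\in L$. *)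

(* Defs.v *)
(* Mathematical Components: finitely supported functions come from multinomials
   ([{malg K[I]}], the free K-module on the type I), complex numbers from
   real-closed ([R[i]]). *)
From HB Require Import structures.
From mathcomp Require Import all_boot all_order all_algebra.
From mathcomp Require Import finmap monalg complex reals ring.

Set Implicit Arguments.
Unset Strict Implicit.
Unset Printing Implicit Defensive.

Import Order.TTheory GRing.Theory Num.Theory.
Local Open Scope ring_scope.

Section LieAlgebras.
Context (K : fieldType) (L : lmodType K).
Implicit Types (br : L -> L -> L) (phi : L -> L).

Definition lie_bracket br : Prop :=
  [/\ forall a u v w, br (a *: u + v) w = a *: br u w + br v w,
      forall a u v w, br w (a *: u + v) = a *: br w u + br w v,
      forall u, br u u = 0
    & forall u v w, br u (br v w) + br v (br w u) + br w (br u v) = 0].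

Definition half_derivation br phi : Prop :=
  linear phi /\
  forall u v, phi (br u v) = 2^-1 *: (br (phi u) v + br u (phi v)).

End LieAlgebras.

Notation Z2 := (int * int)%type.

Section QuantumTorus.
Context (K : fieldType) (t : nat) (q : K).

Definition tZ2 : {pred Z2} := [pred m : Z2 | (t %| m.1)%Z && (t %| m.2)%Z].
Definition Gamma1 : {pred Z2} := [pred m | (m \in tZ2) && (m != 0)].
Definition Gamma2 : {pred Z2} := [pred m | m \notin tZ2].
Definition Gamma : {pred Z2} := [pred m | (m \in Gamma1) || (m \in Gamma2)].

Definition lam (m n : Z2) : K := q ^ (m.2 * n.1) - q ^ (m.1 * n.2).

(* The determinant of the matrix with rows n and m (in this order). *)
Definition det2 (m n : Z2) : K := (m.2 * n.1 - m.1 * n.2)%:~R.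

Definition hcoef (m n : Z2) : K :=
  if m \in Gamma1 then det2 m n else lam m n.

Definition gcoef (m n : Z2) : K :=
  if (m \in Gamma2) && (n \in Gamma2) then lam m n else det2 m n.

(* [inl m] indexes x^m and [inr m] indexes D(m). *)
Definition qtbasis : choiceType :=
  ({m : Z2 | m \in Gamma} + {m : Z2 | m \in Gamma})%type.

Definition qtorus : lmodType K := {malg K[qtbasis]}.

End QuantumTorus.

(* [qtx] and [qtD] are total in m, with value 0 at m = 0. They are locked, like
   [qtbr], so that unification never compares generators by unfolding them. *)
HB.lock Definition qtx (K : fieldType) (t : nat) (m : Z2) : qtorus K t :=
  if insub m is Some k then << (inl k : qtbasis t) >> else 0.

HB.lock Definition qtD (K : fieldType) (t : nat) (m : Z2) : qtorus K t :=
  if insub m is Some k then << (inr k : qtbasis t) >> else 0.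

Definition qtbr_basis (K : fieldType) (t : nat) (q : K) (i j : qtbasis t) :
    qtorus K t :=
  match i, j with
  | inl m, inl n => lam q (val m) (val n) *: qtx K t (val m + val n)
  | inr m, inl n => hcoef t q (val m) (val n) *: qtx K t (val m + val n)
  | inl m, inr n => - hcoef t q (val n) (val m) *: qtx K t (val n + val m)
  | inr m, inr n => gcoef t q (val m) (val n) *: qtD K t (val m + val n)
  end.

HB.lock Definition qtbr (K : fieldType) (t : nat) (q : K) (u v : qtorus K t) :
    qtorus K t :=
  \sum_(i <- msupp u) \sum_(j <- msupp v) (u@_i * v@_j) *: qtbr_basis q i j.

Section LieAlgebraStructure.
Context (K : fieldType) (t : nat) (q : K).
Local Notation X := (qtx K t).
Local Notation D := (qtD K t).
Local Notation br := (@qtbr K t q).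
Local Notation lam := (lam q).
Local Notation det2 := (det2 K).

Lemma GammaE m : (m \in Gamma t) = (m != 0).
Proof.
rewrite !inE; case: (eqVneq m 0) => [->|_]; first by rewrite !dvdz0 andbF.
by rewrite andbT orbN.
Qed.

Lemma qtx0 : X 0 = 0.
Proof. by rewrite unlock insubF // GammaE eqxx. Qed.

Lemma qtD0 : D 0 = 0.
Proof. by rewrite unlock insubF // GammaE eqxx. Qed.

Lemma qtx_inl k : X (val k) = << (inl k : qtbasis t) >>.
Proof. by rewrite unlock valK. Qed.

Lemma qtD_inr k : D (val k) = << (inr k : qtbasis t) >>.
Proof. by rewrite unlock valK. Qed.

Lemma qtbrEw (A B : {fset qtbasis t}) (u v : qtorus K t) :
  (msupp u `<=` A)%fset -> (msupp v `<=` B)%fset ->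
  br u v =
  \sum_(i <- A) \sum_(j <- B) (u@_i * v@_j) *: qtbr_basis q i j.
Proof.
move=> uA vB; rewrite [qtbr]unlock (big_fset_incl _ uA) /=; last first.
  move=> i _ /mcoeff_outdom ui; rewrite big1 // => j _.
  by rewrite ui mul0r scale0r.
apply: eq_bigr => i _; apply: big_fset_incl => // j _ /mcoeff_outdom ->.
by rewrite mulr0 scale0r.
Qed.

Lemma qtbrUU i j : br << i >> << j >> = qtbr_basis q i j.
Proof.
by rewrite (qtbrEw msuppU_le msuppU_le) !big_seq_fset1 !mcoeffUU mulr1 scale1r.
Qed.

Lemma qtbr_linl a u v w : br (a *: u + v) w = a *: br u w + br v w.
Proof.
pose A := (msupp (a *: u + v) `|` (msupp u `|` msupp v))%fset.
have sA : (msupp (a *: u + v) `<=` A)%fset by exact: fsubsetUl.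
have sAu : (msupp u `<=` A)%fset.
  exact: fsubset_trans (fsubsetUl _ _) (fsubsetUr _ _).
have sAv : (msupp v `<=` A)%fset.
  exact: fsubset_trans (fsubsetUr _ _) (fsubsetUr _ _).
have sw := fsubset_refl (msupp w).
rewrite (qtbrEw sA sw) (qtbrEw sAu sw) (qtbrEw sAv sw) scaler_sumr -big_split.
apply: eq_bigr => i _; rewrite scaler_sumr -big_split; apply: eq_bigr => j _ /=.
by rewrite mcoeffD mcoeffZ scalerA -scalerDl mulrDl mulrA.
Qed.

Lemma qtbr_linr a u v w : br w (a *: u + v) = a *: br w u + br w v.
Proof.
pose A := (msupp (a *: u + v) `|` (msupp u `|` msupp v))%fset.
have sA : (msupp (a *: u + v) `<=` A)%fset by exact: fsubsetUl.
have sAu : (msupp u `<=` A)%fset.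
  exact: fsubset_trans (fsubsetUl _ _) (fsubsetUr _ _).
have sAv : (msupp v `<=` A)%fset.
  exact: fsubset_trans (fsubsetUr _ _) (fsubsetUr _ _).
have sw := fsubset_refl (msupp w).
rewrite (qtbrEw sw sA) (qtbrEw sw sAu) (qtbrEw sw sAv) scaler_sumr -big_split.
apply: eq_bigr => i _; rewrite scaler_sumr -big_split; apply: eq_bigr => j _ /=.
by rewrite mcoeffD mcoeffZ scalerA -scalerDl mulrDr mulrCA.
Qed.

Lemma qtbr0l u : br 0 u = 0.
Proof. by rewrite [qtbr]unlock msupp0 big_seq_fset0. Qed.

Lemma qtbr0r u : br u 0 = 0.
Proof. by rewrite [qtbr]unlock big1 // => i _; rewrite msupp0 big_seq_fset0. Qed.

Lemma qtbrDl u v w : br (u + v) w = br u w + br v w.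
Proof. by have := qtbr_linl 1 u v w; rewrite !scale1r. Qed.

Lemma qtbrDr u v w : br w (u + v) = br w u + br w v.
Proof. by have := qtbr_linr 1 u v w; rewrite !scale1r. Qed.

Lemma qtbrZl a u w : br (a *: u) w = a *: br u w.
Proof. by have := qtbr_linl a u 0 w; rewrite qtbr0l !addr0. Qed.

Lemma qtbrZr a u w : br w (a *: u) = a *: br w u.
Proof. by have := qtbr_linr a u 0 w; rewrite qtbr0r !addr0. Qed.

Lemma Gamma1_0 : (0 \in Gamma1 t) = false.
Proof. by rewrite !inE eqxx andbF. Qed.

Lemma Gamma2_0 : (0 \in Gamma2 t) = false.
Proof. by rewrite !inE !dvdz0. Qed.

Lemma qtcoef0 m :
  ((lam m 0 = 0) * (lam 0 m = 0)) * ((det2 m 0 = 0) * (det2 0 m = 0)).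
Proof. by rewrite /lam /det2 /= !mulr0 !mul0r !subrr. Qed.

Lemma qtgen_cases m : m = 0 \/ exists2 k : {m | m \in Gamma t}, m = val k & true.
Proof.
case: (eqVneq m 0) => [|m0]; first by left.
have mG : m \in Gamma t by rewrite GammaE.
by right; exists (Sub m mG); rewrite ?SubK.
Qed.

(* The defining brackets; by the convention on the zero index they hold for
   all m and n. *)
Lemma qtbr_xx m n : br (X m) (X n) = lam m n *: X (m + n).
Proof.
case: (qtgen_cases m) => [->|[k -> _]].
  by rewrite qtx0 qtbr0l qtcoef0 scale0r.
case: (qtgen_cases n) => [->|[l -> _]].
  by rewrite qtx0 qtbr0r qtcoef0 scale0r.
by rewrite !qtx_inl qtbrUU.
Qed.

Lemma qtbr_Dx m n : br (D m) (X n) = hcoef t q m n *: X (m + n).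
Proof.
case: (qtgen_cases m) => [->|[k -> _]].
  by rewrite qtD0 qtbr0l /hcoef Gamma1_0 qtcoef0 scale0r.
case: (qtgen_cases n) => [->|[l -> _]].
  by rewrite qtx0 qtbr0r /hcoef !qtcoef0 if_same scale0r.
by rewrite qtx_inl qtD_inr qtbrUU.
Qed.

Lemma qtbr_xD m n : br (X m) (D n) = - hcoef t q n m *: X (n + m).
Proof.
case: (qtgen_cases n) => [->|[k -> _]].
  by rewrite qtD0 qtbr0r /hcoef Gamma1_0 qtcoef0 oppr0 scale0r.
case: (qtgen_cases m) => [->|[l -> _]].
  by rewrite qtx0 qtbr0l /hcoef !qtcoef0 if_same oppr0 scale0r.
by rewrite qtx_inl qtD_inr qtbrUU.
Qed.

Lemma qtbr_DD m n : br (D m) (D n) = gcoef t q m n *: D (m + n).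
Proof.
case: (qtgen_cases m) => [->|[k -> _]].
  by rewrite qtD0 qtbr0l /gcoef Gamma2_0 andFb qtcoef0 scale0r.
case: (qtgen_cases n) => [->|[l -> _]].
  by rewrite qtD0 qtbr0r /gcoef Gamma2_0 andbF qtcoef0 scale0r.
by rewrite !qtD_inr qtbrUU.
Qed.

Lemma qtU c k : << c *g k >> = c *: << k >> :> qtorus K t.
Proof. by apply/malgP=> l; rewrite mcoeffZ !mcoeffU mulr_natr. Qed.

Lemma qt_lin_eq0 (f : qtorus K t -> qtorus K t) :
  (forall a u v, f (a *: u + v) = a *: f u + f v) ->
  (forall m, f (X m) = 0) -> (forall m, f (D m) = 0) -> forall u, f u = 0.
Proof.
move=> flin fX fD u.
have f0 : f 0 = 0 by have := flin (-1) 0 0; rewrite scaler0 addr0 scaleN1r addNr.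
rewrite [u]monalgE; elim: (enum_fset _) => [|k s IH]; first by rewrite big_nil.
rewrite big_cons qtU flin IH addr0.
case: k => k; first by rewrite -qtx_inl fX scaler0.
by rewrite -qtD_inr fD scaler0.
Qed.

Lemma det2Dr m n k : det2 m (n + k) = det2 m n + det2 m k.
Proof. by rewrite /det2 /= -intrD; congr _%:~R; ring. Qed.

Lemma det2C m n : det2 n m = - det2 m n.
Proof. by rewrite /det2 -intrN; congr _%:~R; ring. Qed.

Lemma lamC m n : lam n m = - lam m n.
Proof. by rewrite /lam opprB [n.2 * _]mulrC [n.1 * _]mulrC. Qed.

Lemma hcoefE m n :
  hcoef t q m n = if m \in tZ2 t then det2 m n else lam m n.
Proof.
rewrite /hcoef !inE; case: (eqVneq m 0) => [->|_]; last by rewrite andbT.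
by rewrite andbF !qtcoef0 if_same.
Qed.

Lemma gcoefE m n : gcoef t q m n =
  if (m \in tZ2 t) || (n \in tZ2 t) then det2 m n else lam m n.
Proof. by rewrite /gcoef !inE -negb_or if_neg. Qed.

Lemma gcoefC m n : gcoef t q n m = - gcoef t q m n.
Proof. by rewrite !gcoefE orbC det2C lamC; case: ifP. Qed.

Lemma tZ2Dl m n : m \in tZ2 t -> (m + n \in tZ2 t) = (n \in tZ2 t).
Proof. by rewrite !inE => /andP[m1 m2]; rewrite !rpredDl. Qed.

Lemma tZ2Dr m n : m \in tZ2 t -> (n + m \in tZ2 t) = (n \in tZ2 t).
Proof. by rewrite addrC; apply: tZ2Dl. Qed.

Lemma qtbrC u v : br u v = - br v u.
Proof.
apply/eqP; rewrite -addr_eq0; apply/eqP.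
apply: (qt_lin_eq0 (f := fun u => br u v + br v u)) => [a u1 u2|m|m].
- by rewrite qtbr_linl qtbr_linr scalerDr addrACA.
- apply: (qt_lin_eq0 (f := fun v => br (X m) v + br v (X m))) => [a v1 v2|n|n].
  + by rewrite qtbr_linl qtbr_linr scalerDr addrACA.
  + by rewrite (qtbr_xx m n) (qtbr_xx n m) (lamC m n) (addrC n m) scaleNr addrN.
  + by rewrite (qtbr_xD m n) (qtbr_Dx n m) scaleNr addNr.
- apply: (qt_lin_eq0 (f := fun v => br (D m) v + br v (D m))) => [a v1 v2|n|n].
  + by rewrite qtbr_linl qtbr_linr scalerDr addrACA.
  + by rewrite (qtbr_xD n m) (qtbr_Dx m n) scaleNr addrN.
  + by rewrite (qtbr_DD m n) (qtbr_DD n m) (gcoefC m n) (addrC n m) scaleNr addrN.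
Qed.

Lemma qtbr_alt u : br u u = 0.
Proof.
rewrite [u in br u _]monalgE [X in br _ X]monalgE.
elim: (enum_fset _) => [|k s IH]; first by rewrite big_nil qtbr0l.
rewrite big_cons qtbrDl !qtbrDr IH addr0 [br (\sum_(_ <- _) _) _]qtbrC addrK.
rewrite qtU qtbrZl qtbrZr.
case: k => k; [rewrite -qtx_inl qtbr_xx | rewrite -qtD_inr qtbr_DD].
  by rewrite /lam [X in q ^ X]mulrC subrr scale0r !scaler0.
rewrite gcoefE /det2 /lam [X in q ^ X]mulrC mulrC !subrr if_same.
by rewrite scale0r !scaler0.
Qed.

Hypothesis q_root : t.-primitive_root q.

Let pw (m n : Z2) : K := q ^ (m.2 * n.1).

Let q_neq0 : q != 0.
Proof.
apply/eqP => q0; have := prim_expr_order q_root.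
rewrite q0 expr0n eqn0Ngt (prim_order_gt0 q_root) => /eqP.
by rewrite eq_sym oner_eq0.
Qed.

Let pwDl m n k : pw (m + n) k = pw m k * pw n k.
Proof. by rewrite /pw /= mulrDl expfzDr. Qed.

Let pwDr m n k : pw k (m + n) = pw k m * pw k n.
Proof. by rewrite /pw /= mulrDr expfzDr. Qed.

Let lamE m n : lam m n = pw m n - pw n m.
Proof. by rewrite /lam /pw [n.2 * _]mulrC. Qed.

Let q_dvd (z : int) : (t %| z)%Z -> q ^ z = 1.
Proof.
case/dvdzP=> y ->; rewrite mulrC -exprz_exp.
by rewrite -exprnP (prim_expr_order q_root) exp1rz.
Qed.

Let pw1l m n : m \in tZ2 t -> pw m n = 1.
Proof. by rewrite !inE => /andP[_ m2]; rewrite /pw q_dvd // dvdz_mulr. Qed.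

Let pw1r m n : m \in tZ2 t -> pw n m = 1.
Proof. by rewrite !inE => /andP[m1 _]; rewrite /pw q_dvd // dvdz_mull. Qed.

Let lam_eq0 m n : m + n \in tZ2 t -> lam m n = 0.
Proof.
move=> mnZ; rewrite lamE.
have nn0 : pw n n != 0 by rewrite /pw expfz_neq0.
apply/eqP; rewrite subr_eq0; apply/eqP/(mulIf nn0).
by rewrite -pwDl -pwDr pw1l ?pw1r.
Qed.

Let jac_lam m n k :
  lam n k * lam m (n + k) + lam k m * lam n (k + m) + lam m n * lam k (m + n)
  = 0.
Proof. rewrite !lamE !(pwDl, pwDr); ring. Qed.

Let jac_det m n k :
  det2 n k * det2 m (n + k) + det2 k m * det2 n (k + m)
  + det2 m n * det2 k (m + n) = 0.
Proof.
rewrite !det2Dr (det2C n m) (det2C n k) (det2C k m); ring.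
Qed.

Let lamDl m n k : m \in tZ2 t -> lam (m + n) k = lam n k.
Proof. by move=> mZ; rewrite !lamE pwDl pwDr (pw1l _ mZ) (pw1r _ mZ) !mul1r. Qed.

Let lamDr m n k : m \in tZ2 t -> lam k (m + n) = lam k n.
Proof. by move=> mZ; rewrite lamC lamDl // -lamC. Qed.

Let lamDl' m n k : m \in tZ2 t -> lam (n + m) k = lam n k.
Proof. by rewrite addrC; apply: lamDl. Qed.

Let lamDr' m n k : m \in tZ2 t -> lam k (n + m) = lam k n.
Proof. by rewrite addrC; apply: lamDr. Qed.

Let lam0l m n : m \in tZ2 t -> lam m n = 0.
Proof. by move=> mZ; rewrite lamE (pw1l _ mZ) (pw1r _ mZ) subrr. Qed.

Let lam0r m n : m \in tZ2 t -> lam n m = 0.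
Proof. by move=> mZ; rewrite lamC lam0l // oppr0. Qed.

Let jac_Dxx m n k :
  lam n k * hcoef t q m (n + k) - hcoef t q m k * lam n (m + k)
  + hcoef t q m n * lam k (m + n) = 0.
Proof.
rewrite !hcoefE; case: ifP => [mZ|_].
  by rewrite !lamDr // det2Dr (lamC n k); ring.
rewrite -[RHS](jac_lam m n k) (lamC m k) [k + m]addrC; ring.
Qed.

Let jac_DDx m n k :
  hcoef t q n k * hcoef t q m (n + k) - hcoef t q m k * hcoef t q n (m + k)
  - gcoef t q m n * hcoef t q (m + n) k = 0.
Proof.
rewrite !hcoefE gcoefE; case: (boolP (m \in tZ2 t)) => mZ /=.
  rewrite tZ2Dl //; case: ifP => nZ.
    rewrite -[RHS](jac_det m n k) [k + m]addrC (det2C m k) (det2C (m + n) k).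
    by ring.
  by rewrite lamDr // lamDl // det2Dr; ring.
case: (boolP (n \in tZ2 t)) => nZ.
  by rewrite tZ2Dr // (negPf mZ) lamDr // lamDl' // det2Dr (det2C m n); ring.
have E : lam m n * (if m + n \in tZ2 t then det2 (m + n) k else lam (m + n) k)
       = lam m n * lam (m + n) k.
  by case: ifP => // /lam_eq0 ->; rewrite !mul0r.
rewrite E -[RHS](jac_lam m n k) (lamC m k) [k + m]addrC (lamC (m + n) k); ring.
Qed.

Let jac_DDD m n k :
  gcoef t q n k * gcoef t q m (n + k) + gcoef t q k m * gcoef t q n (k + m)
  + gcoef t q m n * gcoef t q k (m + n) = 0.
Proof.
have E a b c : a \notin tZ2 t -> b \notin tZ2 t -> c \notin tZ2 t ->
    gcoef t q b c * gcoef t q a (b + c) = lam b c * lam a (b + c).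
  move=> /negPf aZ /negPf bZ /negPf cZ; rewrite !gcoefE aZ bZ cZ /=.
  by case: ifP => // /lam_eq0 ->; rewrite !mul0r.
have F a b c : a \in tZ2 t ->
    gcoef t q b c * gcoef t q a (b + c) + gcoef t q c a * gcoef t q b (c + a)
    + gcoef t q a b * gcoef t q c (a + b) = 0.
  move=> aZ; rewrite !gcoefE aZ (tZ2Dl _ aZ) (tZ2Dr _ aZ) !orbT /= orbC.
  case: ifP => _; first exact: jac_det.
  rewrite (lamDr' _ _ aZ) (lamDr _ _ aZ) det2Dr (lamC b c) (det2C a c); ring.
case: (boolP (m \in tZ2 t)) => mZ; first exact: F.
case: (boolP (n \in tZ2 t)) => nZ.
  by rewrite -[RHS](F n k m nZ) [RHS]addrC addrA.
case: (boolP (k \in tZ2 t)) => kZ.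
  by rewrite -[RHS](F k m n kZ) [LHS]addrC addrA.
by rewrite !E //; exact: jac_lam.
Qed.

Let jac u v w := br u (br v w) + br v (br w u) + br w (br u v).

Let jacC u v w : jac u v w = jac v w u.
Proof. by rewrite /jac [RHS]addrC addrA. Qed.

Let jac_lin v w a u1 u2 : jac (a *: u1 + u2) v w = a *: jac u1 v w + jac u2 v w.
Proof.
rewrite /jac !(qtbr_linl, qtbr_linr) !scalerDr.
by rewrite (addrACA (a *: _)) (addrACA (a *: _ + a *: _)).
Qed.

Let jac_xxx m n k : jac (X m) (X n) (X k) = 0.
Proof.
rewrite /jac (qtbr_xx n k) (qtbr_xx k m) (qtbr_xx m n) !qtbrZr.
rewrite (qtbr_xx m (n + k)) (qtbr_xx n (k + m)) (qtbr_xx k (m + n)) !scalerA.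
have -> : n + (k + m) = m + (n + k) by rewrite addrA addrC.
have -> : k + (m + n) = m + (n + k) by rewrite addrC addrA.
by rewrite -!scalerDl jac_lam scale0r.
Qed.

Let jac_dxx m n k : jac (D m) (X n) (X k) = 0.
Proof.
rewrite /jac (qtbr_xx n k) (qtbr_xD k m) (qtbr_Dx m n) !qtbrZr.
rewrite (qtbr_Dx m (n + k)) (qtbr_xx n (m + k)) (qtbr_xx k (m + n)) !scalerA.
have -> : n + (m + k) = m + (n + k) by rewrite addrCA.
have -> : k + (m + n) = m + (n + k) by rewrite addrC addrA.
by rewrite -!scalerDl mulNr jac_Dxx scale0r.
Qed.

Let jac_ddx m n k : jac (D m) (D n) (X k) = 0.
Proof.
rewrite /jac (qtbr_Dx n k) (qtbr_xD k m) (qtbr_DD m n) !qtbrZr.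
rewrite (qtbr_Dx m (n + k)) (qtbr_Dx n (m + k)) (qtbr_xD k (m + n)) !scalerA.
have -> : n + (m + k) = m + (n + k) by rewrite addrCA.
by rewrite -[m + n + k]addrA -!scalerDl mulNr mulrN jac_DDx scale0r.
Qed.

Let jac_ddd m n k : jac (D m) (D n) (D k) = 0.
Proof.
rewrite /jac (qtbr_DD n k) (qtbr_DD k m) (qtbr_DD m n) !qtbrZr.
rewrite (qtbr_DD m (n + k)) (qtbr_DD n (k + m)) (qtbr_DD k (m + n)) !scalerA.
have -> : n + (k + m) = m + (n + k) by rewrite addrA addrC.
have -> : k + (m + n) = m + (n + k) by rewrite addrC addrA.
by rewrite -!scalerDl jac_DDD scale0r.
Qed.

Let jac_eq0 v w : (forall m, jac (X m) v w = 0) ->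
  (forall m, jac (D m) v w = 0) -> forall u, jac u v w = 0.
Proof.
by move=> jX jD; apply: (qt_lin_eq0 (f := fun u => jac u v w)) => //;
  exact: jac_lin.
Qed.

Theorem qtbr_lie : lie_bracket (@qtbr K t q).
Proof.
split; [exact: qtbr_linl | exact: qtbr_linr | exact: qtbr_alt |].
move=> u v w; rewrite -/(jac u v w).
apply: jac_eq0 => m {u}; rewrite jacC; apply: jac_eq0 => n {v};
  rewrite jacC; apply: jac_eq0 => k {w}; rewrite jacC.
- exact: jac_xxx.
- by rewrite -jacC jac_dxx.
- by rewrite jacC jac_dxx.
- by rewrite jacC jac_ddx.
- exact: jac_dxx.
- by rewrite -jacC jac_ddx.
- exact: jac_ddx.
- exact: jac_ddd.
Qed.

End LieAlgebraStructure.

(* Main.v *)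
Require Import Defs.
From mathcomp Require Import all_boot all_order all_algebra.
From mathcomp Require Import finmap monalg complex reals.
From mathcomp Require Import ring zify.

Import GRing.Theory Num.Theory.
Local Open Scope ring_scope.

(** The bracket is homogeneous for the Z^2-grading, so the homogeneous component
of degree d of a 1/2-derivation phi is given by four scalar functions of m: the
coefficients of phi(x^m) and phi(D(m)) at x^(m+d) and D(m+d).  The elements D(m)
with m in T = (tZ)^2 span a subalgebra whose brackets with all generators have
the determinant as structure constant, and the 1/2-derivation identity for the
brackets [D(m), v] with m in T already determines phi.

It yields two kinds of relation for a coefficient function f of degree d.

- If 2 det(m,n) f(n+m) = det(m,n+d) f(n) for all m in T and all n, then
  f(n) = 0 unless n = 0 or n = -d ([homogeneous_translate_eq0]): applying the
  relation to m twice and to 2m once shows that f(n+m) = f(n), hence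
  det(m,n-d) f(n) = 0, and m may be chosen transversal to any finite set of
  nonzero vectors.

- If 2 det(m,n) f(m+n) = f(m) det(m+d,n) + f(n) det(m,n+d) for m, n in T, then
  f is constant on T \ {0} when d = 0 ([lattice_translate_const]) and vanishes
  there when d <> 0 ([lattice_translate_eq0]).

The coefficient of phi(x^m) at D(m+d) satisfies the first relation, so it is
zero.  The two coefficients of phi(D(m)) satisfy the second one on T.  When
d <> 0 they therefore vanish on T, which turns the relations for all the
remaining coefficients into the first kind: phi has no component of nonzero
degree.  When d = 0 they are constants a (at D) and c (at x) on T \ {0}; the
first kind of relation then holds after subtracting a from the coefficients of
phi(x^m) at x^m and of phi(D(m)) at D(m), and after subtracting c on T and 0 off
T from the coefficient of phi(D(m)) at x^m. *)

(** * Functional equations governed by the determinant *)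

Section Determinant.
Local Set Implicit Arguments.
Local Unset Strict Implicit.
Context (K : numFieldType) (t : nat).
Implicit Types (m n d v : Z2) (f : Z2 -> K).
Local Notation det := (det2 K).
Local Notation T := (tZ2 t).

Lemma det2Dl m n v : det (m + n) v = det m v + det n v.
Proof. by rewrite /det2 /=; ring. Qed.

Lemma det2Nl m v : det (- m) v = - det m v.
Proof. by rewrite /det2 /=; ring. Qed.

Lemma det2Nr m v : det m (- v) = - det m v.
Proof. by rewrite /det2 /=; ring. Qed.

Lemma det2xx m : det m m = 0.
Proof. by rewrite /det2 mulrC subrr. Qed.

Lemma det20r m : det m 0 = 0.
Proof. by rewrite /det2 /= !(mulr0, mul0r) subrr. Qed.

Lemma det20l m : det 0 m = 0.
Proof. by rewrite /det2 /= !(mulr0, mul0r) subrr. Qed.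

Lemma tZ2D m n : m \in T -> n \in T -> m + n \in T.
Proof. by move=> mT nT; rewrite tZ2Dl. Qed.

Lemma tZ2N m : (- m \in T) = (m \in T).
Proof. by rewrite !inE /= !rpredN. Qed.

(** The line of slope N through the origin avoids the given vectors once N exceeds
all their second coordinates in absolute value. *)
Lemma exists_transversal (s : seq Z2) : (0 < t)%N -> 0 \notin s ->
  exists2 m, m \in T & {in s, forall v, det m v != 0}.
Proof.
move=> t0 s0.
pose N : nat := (\sum_(v <- s) `|v.2|)%N.+1.
exists (t%:Z, t%:Z * N%:Z); first by rewrite !inE /= dvdz_mulr dvdzz.
move=> v vs; rewrite /det2 intr_eq0 /=.
have vN : (`|v.2| < N)%N.
  by rewrite ltnS (big_rem v vs) leq_addr.
have : v != 0 by apply: contraNneq s0 => <-.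
case: v {vs} vN => v1 v2 /= vN v0.
rewrite -mulrA -mulrBr mulf_neq0 //; first by lia.
apply: contra v0 => /eqP E.
have {E}v2E : v2 = N%:Z * v1 by apply/esym/eqP; rewrite -subr_eq0 E.
have : (`|v1| == 0)%N.
  rewrite -leqn0 -ltnS -(ltn_pmul2l (isT : (0 < N)%N)) muln1.
  by rewrite v2E abszM in vN.
by rewrite absz_eq0 => /eqP v10; rewrite v2E v10 mulr0.
Qed.

(** With A = det(m,n) and B = det(m,n+d), the relation at (m,n), (m,n+m) and (2m,n)
reads 2A f(n+m) = B f(n), 2A f(n+2m) = B f(n+m) and 4A f(n+2m) = 2B f(n).  Hence
f(n+m) = f(n) and (2A - B) f(n) = det(m,n-d) f(n) = 0.  The value n = d, where this
factor vanishes identically, is recovered from a translate of d. *)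
Lemma homogeneous_translate_eq0 d f : (0 < t)%N ->
  (forall m n, m \in T -> 2 * det m n * f (n + m) = det m (n + d) * f n) ->
  forall n, n != 0 -> n + d != 0 -> f n = 0.
Proof.
move=> t0 H.
have generic n : n != 0 -> n + d != 0 -> n - d != 0 -> f n = 0.
  move=> n0 nd0 nd0'.
  have [|m mT mP] := @exists_transversal [:: n; n + d; n - d] t0.
    by rewrite !inE ![0 == _]eq_sym !negb_or n0 nd0 nd0'.
  have A0 : det m n != 0 by apply: mP; rewrite !inE eqxx.
  have B0 : det m (n + d) != 0 by apply: mP; rewrite !inE eqxx orbT.
  have C0 : det m (n - d) != 0 by apply: mP; rewrite !inE eqxx !orbT.
  have E1 := H m n mT.
  have E2 := H m (n + m) mT; have E3 := H (m + m) n (tZ2D mT mT).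
  rewrite -addrA !(det2Dr, det2xx) !addr0 in E2.
  rewrite !(det2Dr, det2Dl) in E3.
  rewrite !(det2Dr, det2Nr) in B0 C0 E1.
  have fE : f (n + m) = f n.
    apply: (mulfI B0); rewrite -E2; apply: (@mulfI _ 2); first by rewrite pnatr_eq0.
    by transitivity (2 * (det m n + det m n) * f (n + (m + m)));
       [ring | rewrite E3; ring].
  apply: (mulfI C0); rewrite mulr0.
  transitivity (2 * det m n * f n - (det m n + det m d) * f n); first by ring.
  by rewrite -E1 fE subrr.
move=> n n0 nd0; have [E|nd] := eqVneq n d; last first.
  by apply: (generic n n0 nd0); rewrite subr_eq0.
have [|m mT mP] := @exists_transversal [:: n] t0; first by rewrite inE eq_sym.
have A0 : det m n != 0 by apply: mP; rewrite inE.
have nz x : det m x != 0 -> x != 0 by apply: contraNneq => ->; rewrite det20r.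
have := H m n mT; rewrite -E det2Dr generic ?mulr0.
- by move/esym/eqP; rewrite mulf_eq0 -mulr2n mulrn_eq0 (negPf A0) => /eqP.
- by apply: nz; rewrite det2Dr det2xx addr0.
- by apply: nz; rewrite -E !det2Dr det2xx addr0 -mulr2n mulrn_eq0.
- rewrite -E addrC addrA addNr add0r.
  by apply: contraNneq A0 => ->; rewrite det20l.
Qed.

(** The closed sequence a_1, ..., a_6, a_1 is an arithmetic progression, of common
difference r say; thus a_1 = a_1 + 6r and r = 0. *)
Lemma hexagon (a1 a2 a3 a4 a5 a6 : K) :
  2 * a2 = a1 + a3 -> 2 * a3 = a2 + a4 -> 2 * a4 = a3 + a5 ->
  2 * a5 = a4 + a6 -> 2 * a6 = a5 + a1 -> a1 = a3.
Proof.
move=> e2 e3 e4 e5 e6.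
have step (x y z : K) : 2 * y = x + z -> z = 2 * y - x.
  by move=> ->; rewrite addrC addKr.
have E3 := step _ _ _ e2; have E4 := step _ _ _ e3; have E5 := step _ _ _ e4.
have E6 := step _ _ _ e5; have E1 := step _ _ _ e6.
suff /eqP: 6 * (a2 - a1) = 0.
  rewrite mulf_eq0 pnatr_eq0 /= subr_eq0 => /eqP e.
  by rewrite E3 e; ring.
transitivity ((2 * a6 - a5) - a1); last by rewrite -E1 subrr.
by rewrite E6 E5 E4 E3; ring.
Qed.

(** For independent m and n the relation says that f is midpoint-affine on the
hexagon m, m+n, n, -m, -m-n, -n, so f m = f n; two arbitrary nonzero points are
compared through a third one independent of both. *)
Lemma lattice_translate_const f : (0 < t)%N ->
  (forall m n, m \in T -> n \in T ->
     2 * det m n * f (m + n) = f m * det m n + f n * det m n) ->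
  forall m n, m \in T -> n \in T -> m != 0 -> n != 0 -> f m = f n.
Proof.
move=> t0 H.
have P m n : m \in T -> n \in T -> det m n != 0 -> 2 * f (m + n) = f m + f n.
  by move=> mT nT A0; apply: (mulfI A0); have := H m n mT nT => E;
     transitivity (2 * det m n * f (m + n)); [ring | rewrite E; ring].
have Q m n : m \in T -> n \in T -> det m n != 0 -> f m = f n.
  move=> mT nT A0.
  have A0' : det n m != 0 by rewrite det2C oppr_eq0.
  have mnT := tZ2D mT nT.
  apply: (@hexagon _ (f (m + n)) _ (f (- m)) (f (- m - n)) (f (- n))).
  - exact: P.
  - rewrite -P ?tZ2N //; first by rewrite addrAC subrr add0r.
    by rewrite !(det2Nr, det2Dl, det2xx) add0r oppr_eq0.
  - rewrite -P ?tZ2D ?tZ2N //; first by rewrite addrC subrK.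
    by rewrite !(det2Nr, det2Dr, det2xx) subr0 oppr_eq0.
  - by rewrite -P ?tZ2N // det2Nr det2Nl opprK.
  - rewrite -P ?tZ2D ?tZ2N //; first by rewrite addrAC addNr add0r.
    by rewrite !(det2Nl, det2Dl, det2xx) oppr0 add0r oppr_eq0.
move=> m n mT nT m0 n0.
have [|k kT kP] := @exists_transversal [:: m; n] t0.
  by rewrite !inE ![0 == _]eq_sym negb_or m0 n0.
rewrite -(Q k m) ?(Q k n) //; by apply: kP; rewrite !inE eqxx ?orbT.
Qed.

(** The relation at (m,-m) makes f odd at points transversal to d.  The
difference of the relations at (m,n) and (-m,-n) then cancels the terms linear in d and leaves
2 f(m+n) = f(m) + f(n).  The same midpoint relation at (m+n,-n) and (m+n,-m),
combined with oddness, forces f(m) = 0.  A point parallel to d is a sum of two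
transversal ones. *)
Lemma lattice_translate_eq0 d f : (0 < t)%N -> d != 0 ->
  (forall m n, m \in T -> n \in T ->
     2 * det m n * f (m + n) = f m * det (m + d) n + f n * det m (n + d)) ->
  forall m, m \in T -> m != 0 -> f m = 0.
Proof.
move=> t0 d0 H.
have fN m : m \in T -> det m d != 0 -> f (- m) = - f m.
  move=> mT u0; have := H m (- m) mT; rewrite tZ2N => /(_ mT).
  rewrite !(det2Nr, det2Dl, det2Dr, det2xx) (det2C _ m d) oppr0 mulr0 mul0r.
  rewrite !add0r opprK -mulrDl => /esym/eqP.
  by rewrite mulf_eq0 (negPf u0) orbF addrC addr_eq0 => /eqP.
have P m n : m \in T -> n \in T -> det m n != 0 ->
    det m d != 0 -> det n d != 0 -> det (m + n) d != 0 ->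
    2 * f (m + n) = f m + f n.
  move=> mT nT A0 u0 v0 uv0.
  have E1 := H m n mT nT.
  have := H (- m) (- n); rewrite !tZ2N -opprD => /(_ mT nT) E2.
  rewrite !fN ?tZ2D // !(det2Nr, det2Nl, det2Dl, det2Dr) (det2C _ n d) in E1 E2.
  apply: (@mulfI _ (2 * det m n)); first by rewrite mulf_neq0 ?pnatr_eq0.
  transitivity (2 * det m n * f (m + n) - 2 * - - det m n * - f (m + n)); first by ring.
  by rewrite E1 E2; ring.
have transverse m : m \in T -> det m d != 0 -> f m = 0.
  move=> mT u0.
  have [n [nT A0 v0 uv0]] :
      exists n, [/\ n \in T, det m n != 0, det n d != 0 & det (m + n) d != 0].
    have [|n nT nP] := @exists_transversal [:: m; d] t0.
      rewrite !inE ![0 == _]eq_sym negb_or d0 andbT.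
      by apply: contraNneq u0 => ->; rewrite det20l.
    have A0 : det m n != 0 by rewrite det2C oppr_eq0 nP // !inE eqxx.
    have v0 : det n d != 0 by rewrite nP // !inE eqxx orbT.
    (* det(m+n,d) and det(m-n,d) cannot both vanish, as det(m,d) is nonzero. *)
    have [E|] := eqVneq (det (m + n) d) 0; last by exists n.
    exists (- n); rewrite tZ2N det2Nr det2Nl !oppr_eq0; split=> //.
    rewrite det2Dl det2Nl; move/eqP: E; rewrite det2Dl addr_eq0 => /eqP <-.
    by rewrite -mulr2n mulrn_eq0.
  have A0' : det n m != 0 by rewrite det2C oppr_eq0.
  have mnT := tZ2D mT nT.
  have E := P _ _ mT nT A0 u0 v0 uv0.
  have Em : 2 * f m = f (m + n) - f n.
    rewrite -fN // -P ?addrK ?tZ2N //.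
      by rewrite !(det2Nr, det2Dl, det2xx) addr0 oppr_eq0.
    by rewrite det2Nl oppr_eq0.
  have En : 2 * f n = f (m + n) - f m.
    rewrite -fN // -P ?tZ2N //; first by rewrite addrAC subrr add0r.
    - by rewrite !(det2Nr, det2Dl, det2xx) add0r oppr_eq0.
    - by rewrite det2Nl oppr_eq0.
    - by rewrite addrAC subrr add0r.
  have four : (4 : K) != 0 by rewrite pnatr_eq0.
  apply: (mulfI four); rewrite mulr0.
  transitivity ((2 * f (m + n) - (f m + f n)) + 3 * (2 * f m - (f (m + n) - f n))
                - (2 * f n - (f (m + n) - f m))); first by ring.
  by rewrite E Em En !subrr; ring.
move=> m mT m0; have [u0|] := eqVneq (det m d) 0; last exact: transverse.
have [|n nT nP] := @exists_transversal [:: m; d] t0.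
  by rewrite !inE ![0 == _]eq_sym negb_or d0 m0.
have A0 : det n m != 0 by rewrite nP // !inE eqxx.
have v0 : det n d != 0 by rewrite nP // !inE eqxx orbT.
have := H (m + n) (- n); rewrite tZ2D // tZ2N // => /(_ isT nT).
rewrite addrK (transverse (m + n)) ?(transverse (- n)) ?tZ2D ?tZ2N //;
  rewrite ?det2Dl ?det2Nl ?oppr_eq0 ?u0 ?add0r //.
rewrite !mul0r addr0 => /eqP.
rewrite !det2Nr det2xx oppr0 addr0 (det2C _ n m) opprK mulf_eq0 mulf_eq0.
by rewrite pnatr_eq0 (negPf A0) => /eqP.
Qed.

End Determinant.

(** * Coefficients of brackets *)

Section Coefficients.
Local Set Implicit Arguments.
Local Unset Strict Implicit.
Context (K : fieldType) (t : nat) (q : K).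
Implicit Types (k m n : Z2) (u v : qtorus K t).
Local Notation X := (qtx K t).
Local Notation D := (qtD K t).
Local Notation br := (qtbr q).

(** The value at k = 0 is 0, in accordance with x^0 = 0; this makes the formulas
below for the coefficients of a bracket valid in all degrees. *)
Definition coefx k u : K :=
  if insub k is Some i then u@_(inl i : qtbasis t) else 0.

Definition coefD k u : K :=
  if insub k is Some i then u@_(inr i : qtbasis t) else 0.

Lemma coefx_lin k a u v : coefx k (a *: u + v) = a * coefx k u + coefx k v.
Proof.
by rewrite /coefx; case: insub => [i|]; rewrite ?mcoeffD ?mcoeffZ // mulr0 addr0.
Qed.

Lemma coefD_lin k a u v : coefD k (a *: u + v) = a * coefD k u + coefD k v.
Proof.
by rewrite /coefD; case: insub => [i|]; rewrite ?mcoeffD ?mcoeffZ // mulr0 addr0.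
Qed.

Lemma coefx0 k : coefx k 0 = 0.
Proof. by rewrite /coefx; case: insub => // i; rewrite mcoeff0. Qed.

Lemma coefD0 k : coefD k 0 = 0.
Proof. by rewrite /coefD; case: insub => // i; rewrite mcoeff0. Qed.

Lemma coefxZ k a u : coefx k (a *: u) = a * coefx k u.
Proof. by rewrite -[a *: u]addr0 coefx_lin coefx0 addr0. Qed.

Lemma coefDZ k a u : coefD k (a *: u) = a * coefD k u.
Proof. by rewrite -[a *: u]addr0 coefD_lin coefD0 addr0. Qed.

Lemma coefx_add k u v : coefx k (u + v) = coefx k u + coefx k v.
Proof. by have := coefx_lin k 1 u v; rewrite scale1r mul1r. Qed.

Lemma coefD_add k u v : coefD k (u + v) = coefD k u + coefD k v.
Proof. by have := coefD_lin k 1 u v; rewrite scale1r mul1r. Qed.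

Lemma coefx_at0 u : coefx 0 u = 0.
Proof. by rewrite /coefx insubF // GammaE eqxx. Qed.

Lemma coefD_at0 u : coefD 0 u = 0.
Proof. by rewrite /coefD insubF // GammaE eqxx. Qed.

Lemma coefx_X k m : coefx k (X m) = ((m == k) && (k != 0))%:R.
Proof.
case: (qtgen_cases t k) => [->|[i -> _]]; first by rewrite coefx_at0 eqxx andbF.
have := valP i; rewrite GammaE => ->; rewrite andbT.
case: (qtgen_cases t m) => [->|[j -> _]].
  by have := valP i; rewrite GammaE eq_sym => /negPf ->; rewrite qtx0 coefx0.
by rewrite qtx_inl /coefx valK /= mcoeffU.
Qed.

Lemma coefx_D k m : coefx k (D m) = 0.
Proof.
case: (qtgen_cases t k) => [->|[i -> _]]; first by rewrite coefx_at0.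
case: (qtgen_cases t m) => [->|[j -> _]]; first by rewrite qtD0 coefx0.
by rewrite qtD_inr /coefx valK /= mcoeffU.
Qed.

Lemma coefD_D k m : coefD k (D m) = ((m == k) && (k != 0))%:R.
Proof.
case: (qtgen_cases t k) => [->|[i -> _]]; first by rewrite coefD_at0 eqxx andbF.
have := valP i; rewrite GammaE => ->; rewrite andbT.
case: (qtgen_cases t m) => [->|[j -> _]].
  by have := valP i; rewrite GammaE eq_sym => /negPf ->; rewrite qtD0 coefD0.
by rewrite qtD_inr /coefD valK /= mcoeffU.
Qed.

Lemma coefD_X k m : coefD k (X m) = 0.
Proof.
case: (qtgen_cases t k) => [->|[i -> _]]; first by rewrite coefD_at0.
case: (qtgen_cases t m) => [->|[j -> _]]; first by rewrite qtx0 coefD0.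
by rewrite qtx_inl /coefD valK /= mcoeffU.
Qed.

Lemma qtorus_coefP u v : (forall k, k != 0 -> coefx k u = coefx k v) ->
  (forall k, k != 0 -> coefD k u = coefD k v) -> u = v.
Proof.
move=> Hx HD; apply/malgP => -[k|k]; have := valP k; rewrite GammaE => k0.
  by have := Hx _ k0; rewrite /coefx valK.
by have := HD _ k0; rewrite /coefD valK.
Qed.

Lemma qtorus_functional_ext (F G : qtorus K t -> K) :
  (forall a u v, F (a *: u + v) = a * F u + F v) ->
  (forall a u v, G (a *: u + v) = a * G u + G v) ->
  (forall m, F (X m) = G (X m)) -> (forall m, F (D m) = G (D m)) ->
  forall u, F u = G u.
Proof.
move=> Flin Glin EX ED u.
have H0 (H : qtorus K t -> K) :
    (forall a u v, H (a *: u + v) = a * H u + H v) -> H 0 = 0.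
  by move=> Hlin; have := Hlin (-1) 0 0; rewrite scaler0 addr0 mulN1r addNr.
rewrite [u]monalgE; elim: (enum_fset _) => [|k s IH].
  by rewrite big_nil !H0.
rewrite big_cons qtU Flin Glin IH.
by case: k => k; rewrite -?qtx_inl -?qtD_inr ?EX ?ED.
Qed.

Let lam_opp k n : k + n = 0 -> lam q k n = 0.
Proof.
move/eqP; rewrite addrC addr_eq0 => /eqP ->.
by rewrite /lam /= !mulrN [_.2 * _]mulrC subrr.
Qed.

Let det2_opp k n : k + n = 0 -> det2 K k n = 0.
Proof.
move/eqP; rewrite addrC addr_eq0 => /eqP ->.
by rewrite /det2 /= !mulrN [_.2 * _]mulrC subrr.
Qed.

Let hcoef_opp k n : k + n = 0 -> hcoef t q k n = 0.
Proof. by move=> kn; rewrite /hcoef lam_opp // det2_opp // if_same. Qed.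

Let gcoef_opp k n : k + n = 0 -> gcoef t q k n = 0.
Proof. by move=> kn; rewrite /gcoef lam_opp // det2_opp // if_same. Qed.

(** A structure constant c(k,n) vanishes when k or k+n is 0, which is what makes
the conventions at index 0 consistent. *)
Let generator_coef (c : Z2 -> Z2 -> K) m k n :
  c 0 n = 0 -> (k + n = 0 -> c k n = 0) ->
  c m n * ((m + n == k + n) && (k + n != 0))%:R =
  c k n * ((m == k) && (k != 0))%:R.
Proof.
move=> c0 c0'; rewrite (inj_eq (addIr n)).
case: eqP => [->|_]; last by rewrite !mulr0.
case: (eqVneq k 0) => [->|_]; first by rewrite c0 !mul0r.
by case: eqVneq => // /c0' ->; rewrite !mul0r.
Qed.

Lemma coefx_brX k n u :
  coefx (k + n) (br u (X n)) = lam q k n * coefx k u + hcoef t q k n * coefD k u.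
Proof.
move: u; apply: qtorus_functional_ext => [a u v|a u v|m|m].
- by rewrite qtbr_linl coefx_lin.
- by rewrite coefx_lin coefD_lin; ring.
- rewrite qtbr_xx coefxZ !coefx_X coefD_X mulr0 addr0.
  by apply: generator_coef; [rewrite qtcoef0 | exact: lam_opp].
- rewrite qtbr_Dx coefxZ coefx_X coefx_D coefD_D mulr0 add0r.
  apply: generator_coef; last exact: hcoef_opp.
  by rewrite /hcoef Gamma1_0 (qtcoef0 q).
Qed.

Lemma coefD_brX k n u : coefD k (br u (X n)) = 0.
Proof.
move: u; apply: (qtorus_functional_ext (G := fun _ => 0)) => [a u v|a u v|m|m].
- by rewrite qtbr_linl coefD_lin.
- by rewrite mulr0 addr0.
- by rewrite qtbr_xx coefDZ coefD_X mulr0.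
- by rewrite qtbr_Dx coefDZ coefD_X mulr0.
Qed.

Lemma coefx_brD k n u : coefx (k + n) (br u (D n)) = - hcoef t q n k * coefx k u.
Proof.
move: u; apply: qtorus_functional_ext => [a u v|a u v|m|m].
- by rewrite qtbr_linl coefx_lin.
- by rewrite coefx_lin; ring.
- rewrite qtbr_xD coefxZ !coefx_X [n + m]addrC.
  apply: (generator_coef (c := fun k n => - hcoef t q n k)).
    by rewrite /hcoef !(qtcoef0 q) if_same oppr0.
  by move=> kn; rewrite hcoef_opp ?oppr0 // addrC.
- by rewrite qtbr_DD coefxZ !coefx_D !mulr0.
Qed.

Lemma coefD_brD k n u : coefD (k + n) (br u (D n)) = gcoef t q k n * coefD k u.
Proof.
move: u; apply: qtorus_functional_ext => [a u v|a u v|m|m].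
- by rewrite qtbr_linl coefD_lin.
- by rewrite coefD_lin; ring.
- by rewrite qtbr_xD coefDZ !coefD_X !mulr0.
- rewrite qtbr_DD coefDZ !coefD_D.
  apply: (generator_coef (c := gcoef t q)); last exact: gcoef_opp.
  by rewrite /gcoef Gamma2_0 andFb (qtcoef0 q).
Qed.

Lemma coefx_Dbr k m u : coefx (m + k) (br (D m) u) = hcoef t q m k * coefx k u.
Proof.
by rewrite qtbrC -scaleN1r coefxZ addrC coefx_brD mulN1r mulNr opprK.
Qed.

Lemma coefD_Dbr k m u : coefD (m + k) (br (D m) u) = gcoef t q m k * coefD k u.
Proof.
by rewrite qtbrC -scaleN1r coefDZ addrC coefD_brD mulN1r -mulNr -gcoefC.
Qed.

End Coefficients.

(** * Homogeneous components of a 1/2-derivation *)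

Section HalfDerivation.
Local Set Implicit Arguments.
Local Unset Strict Implicit.
Context (K : numFieldType) (t : nat) (q : K) (phi : qtorus K t -> qtorus K t).
Implicit Types (k m n d : Z2) (u v : qtorus K t).
Context (q_root : t.-primitive_root q) (phiH : half_derivation (qtbr q) phi).
Local Notation X := (qtx K t).
Local Notation D := (qtD K t).
Local Notation T := (tZ2 t).
Local Notation det := (det2 K).
Local Notation br := (qtbr q).

Let t_gt0 : (0 < t)%N. Proof. exact: prim_order_gt0 q_root. Qed.

Let phi0 : phi 0 = 0.
Proof.
by case: phiH => lin _; have := lin (-1) 0 0; rewrite scaler0 addr0 scaleN1r addNr.
Qed.

Let phiZ a u : phi (a *: u) = a *: phi u.
Proof. by case: phiH => lin _; rewrite -[a *: u]addr0 lin phi0 addr0. Qed.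

Let phi_br u v : 2 *: phi (br u v) = br (phi u) v + br u (phi v).
Proof. by case: phiH => _ ->; rewrite scalerA mulfV ?pnatr_eq0 // scale1r. Qed.

(** The entries of the degree d component of phi: phi(x^m) is the sum over d of
phixx d m x^(m+d) + phixD d m D(m+d), and phi(D(m)) that of
phiDx d m x^(m+d) + phiDD d m D(m+d). *)
Definition phixx d m := coefx (m + d) (phi (X m)).
Definition phixD d m := coefD (m + d) (phi (X m)).
Definition phiDx d m := coefx (m + d) (phi (D m)).
Definition phiDD d m := coefD (m + d) (phi (D m)).

Let hT m n : m \in T -> hcoef t q m n = det m n.
Proof. by move=> mT; rewrite hcoefE mT. Qed.

Let gTl m n : m \in T -> gcoef t q m n = det m n.
Proof. by move=> mT; rewrite gcoefE mT. Qed.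

Let gTr m n : n \in T -> gcoef t q m n = det m n.
Proof. by move=> nT; rewrite gcoefE nT orbT. Qed.

Let lamT m n : m \in T -> lam q m n = 0 /\ lam q n m = 0.
Proof.
have q_dvd (z : int) : (t %| z)%Z -> q ^ z = 1.
  case/dvdzP=> y ->; rewrite mulrC -exprz_exp.
  by rewrite -exprnP (prim_expr_order q_root) exp1rz.
rewrite !inE => /andP[m1 m2]; rewrite /lam.
by split; rewrite !q_dvd ?subrr //; (exact: dvdz_mulr || exact: dvdz_mull).
Qed.

(** The four relations below are the homogeneous components of the 1/2-derivation
identity for [D(m), x^n] and [D(m), D(n)], where m lies in T. *)
Lemma phixx_rel d m n : m \in T ->
  2 * det m n * phixx d (n + m) =
  lam q (m + d) n * phiDx d m + hcoef t q (m + d) n * phiDD d m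
  + det m (n + d) * phixx d n.
Proof.
move=> mT; rewrite /phixx /phiDx /phiDD -(hT _ mT) -(hT (n + d) mT).
rewrite -coefx_brX -coefx_Dbr.
rewrite addrA addrAC -coefx_add -phi_br qtbr_Dx phiZ !coefxZ mulrA.
by rewrite [n + m]addrC addrAC.
Qed.

Lemma phixD_rel d m n : m \in T ->
  2 * det m n * phixD d (n + m) = det m (n + d) * phixD d n.
Proof.
move=> mT; rewrite /phixD -(hT _ mT) -(gTl (n + d) mT) -coefD_Dbr.
rewrite addrA -[RHS]add0r -(coefD_brX q (m + n + d) n (phi (D m))).
by rewrite -coefD_add -phi_br qtbr_Dx phiZ !coefDZ mulrA [n + m]addrC.
Qed.

Lemma phiDx_rel d m n : m \in T ->
  2 * det m n * phiDx d (n + m) =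
  - hcoef t q n (m + d) * phiDx d m + det m (n + d) * phiDx d n.
Proof.
move=> mT; rewrite /phiDx -(gTl _ mT) -(hT (n + d) mT) -coefx_brD -coefx_Dbr.
rewrite addrA addrAC -coefx_add -phi_br qtbr_DD phiZ !coefxZ mulrA.
by rewrite [n + m]addrC addrAC.
Qed.

Lemma phiDD_rel d m n : m \in T ->
  2 * det m n * phiDD d (n + m) =
  gcoef t q (m + d) n * phiDD d m + det m (n + d) * phiDD d n.
Proof.
move=> mT; rewrite /phiDD -(gTl n mT) -(gTl (n + d) mT) -coefD_brD -coefD_Dbr.
rewrite addrA addrAC -coefD_add -phi_br qtbr_DD phiZ !coefDZ mulrA.
by rewrite [n + m]addrC addrAC.
Qed.

Lemma phixD_eq0 d n : phixD d n = 0.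
Proof.
have [->|n0] := eqVneq n 0; first by rewrite /phixD qtx0 phi0 coefD0.
have [E|nd0] := eqVneq (n + d) 0; first by rewrite /phixD E coefD_at0.
by apply: (homogeneous_translate_eq0 t_gt0) n0 nd0 => m k; apply: phixD_rel.
Qed.

(** ** Nonzero degree *)

Lemma phiDD_lattice_eq0 d m : d != 0 -> m \in T -> phiDD d m = 0.
Proof.
move=> d0 mT; have [->|m0] := eqVneq m 0; first by rewrite /phiDD qtD0 phi0 coefD0.
apply: (lattice_translate_eq0 t_gt0 d0) mT m0 => k n kT nT.
by rewrite addrC phiDD_rel // gTr // mulrC [det k _ * _]mulrC.
Qed.

Lemma phiDx_lattice_eq0 d m : d != 0 -> m \in T -> phiDx d m = 0.
Proof.
move=> d0 mT; have [->|m0] := eqVneq m 0; first by rewrite /phiDx qtD0 phi0 coefx0.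
apply: (lattice_translate_eq0 t_gt0 d0) mT m0 => k n kT nT.
by rewrite addrC phiDx_rel // hT // -det2C mulrC [det k _ * _]mulrC.
Qed.

Lemma phixx_off_diagonal d m : d != 0 -> m != 0 -> phixx d m = 0.
Proof.
move=> d0 m0; have [E|md0] := eqVneq (m + d) 0; first by rewrite /phixx E coefx_at0.
apply: (homogeneous_translate_eq0 t_gt0) m0 md0 => k n kT.
by rewrite phixx_rel // phiDx_lattice_eq0 // phiDD_lattice_eq0 // !mulr0 !add0r.
Qed.

Lemma phiDx_off_diagonal d m : d != 0 -> m != 0 -> phiDx d m = 0.
Proof.
move=> d0 m0; have [E|md0] := eqVneq (m + d) 0; first by rewrite /phiDx E coefx_at0.
apply: (homogeneous_translate_eq0 t_gt0) m0 md0 => k n kT.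
by rewrite phiDx_rel // (phiDx_lattice_eq0 d0) // mulr0 add0r.
Qed.

Lemma phiDD_off_diagonal d m : d != 0 -> m != 0 -> phiDD d m = 0.
Proof.
move=> d0 m0; have [E|md0] := eqVneq (m + d) 0; first by rewrite /phiDD E coefD_at0.
apply: (homogeneous_translate_eq0 t_gt0) m0 md0 => k n kT.
by rewrite phiDD_rel // (phiDD_lattice_eq0 d0) // mulr0 add0r.
Qed.

(** ** Degree zero *)

(* A reference point of T \ {0}, at which the scalars a and c are read off. *)
Let e : Z2 := (t%:Z, 0).

Let eT : e \in T.
Proof. by rewrite !inE /= dvdz0 dvdzz. Qed.

Let e_neq0 : e != 0.
Proof. by apply/eqP => -[] t0; move: t_gt0; rewrite t0. Qed.

Lemma phiDD_lattice_const m : m \in T -> m != 0 -> phiDD 0 m = phiDD 0 e.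
Proof.
move=> mT m0; apply: (lattice_translate_const t_gt0 _ mT eT m0 e_neq0).
move=> k n kT nT; rewrite addrC phiDD_rel // gTr // !addr0.
by rewrite mulrC [det k _ * phiDD _ n]mulrC.
Qed.

Lemma phiDx_lattice_const m : m \in T -> m != 0 -> phiDx 0 m = phiDx 0 e.
Proof.
move=> mT m0; apply: (lattice_translate_const t_gt0 _ mT eT m0 e_neq0).
move=> k n kT nT; rewrite addrC phiDx_rel // hT // -det2C !addr0.
by rewrite mulrC [det k _ * phiDx _ n]mulrC.
Qed.

(** In degree zero the determinant cancels, except where it vanishes and the
relation to be proved is trivial. *)
Let diagonal (f : Z2 -> K) : (forall m n, m \in T -> det m n != 0 ->
    2 * f (n + m) = f n) -> forall m, m != 0 -> f m = 0.
Proof.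
move=> H m m0; apply: (homogeneous_translate_eq0 t_gt0 _ m0 (d := 0)).
  move=> k n kT; have [A0|A0] := eqVneq (det k n) 0.
    by rewrite addr0 A0 mulr0 !mul0r.
  by rewrite addr0 -(H k n) //; ring.
by rewrite addr0.
Qed.

Let det_neq0 m n : det m n != 0 -> [/\ m != 0, n != 0 & n + m != 0].
Proof.
move=> A0; split; apply: contraNneq A0 => E; rewrite ?E ?det20l ?det20r ?eqxx //.
have -> : det m n = det m (n + m) by rewrite det2Dr det2xx addr0.
by rewrite E det20r.
Qed.

Lemma phiDD_diagonal m : m != 0 -> phiDD 0 m = phiDD 0 e.
Proof.
move=> m0; apply/eqP; rewrite -subr_eq0; apply/eqP.
apply: (@diagonal (fun m => phiDD 0 m - phiDD 0 e)) m0 => {}m n mT A0.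
have [m0 _ _] := det_neq0 A0; have := phiDD_rel 0 n mT.
rewrite !addr0 gTl // (phiDD_lattice_const mT m0) => E.
apply: (mulfI A0).
transitivity (2 * det m n * phiDD 0 (n + m) - 2 * det m n * phiDD 0 e); first by ring.
by rewrite E; ring.
Qed.

Lemma phixx_diagonal m : m != 0 -> phixx 0 m = phiDD 0 e.
Proof.
move=> m0; apply/eqP; rewrite -subr_eq0; apply/eqP.
apply: (@diagonal (fun m => phixx 0 m - phiDD 0 e)) m0 => {}m n mT A0.
have [m0 _ _] := det_neq0 A0; have := phixx_rel 0 n mT.
have [l0 _] := lamT n mT; rewrite !addr0 l0 hT // (phiDD_lattice_const mT m0) => E.
apply: (mulfI A0).
transitivity (2 * det m n * phixx 0 (n + m) - 2 * det m n * phiDD 0 e); first by ring.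
by rewrite E; ring.
Qed.

(** Off T the coefficient hcoef(n,m) is lam(n,m), which vanishes for m in T, so
2 f(n+m) = f(n) holds there without any correction by c. *)
Lemma phiDx_diagonal m : m != 0 -> phiDx 0 m = if m \in T then phiDx 0 e else 0.
Proof.
move=> m0; apply/eqP; rewrite -subr_eq0; apply/eqP.
apply: (@diagonal (fun m => phiDx 0 m - if m \in T then phiDx 0 e else 0)) m0.
move=> {}m n mT A0; have [m0 n0 nm0] := det_neq0 A0; rewrite tZ2Dr //.
case: ifPn => nT.
  rewrite (phiDx_lattice_const nT n0) (phiDx_lattice_const (tZ2D nT mT) nm0).
  by rewrite subrr mulr0.
have := phiDx_rel 0 n mT; have [_ l0] := lamT n mT.
rewrite !addr0 !subr0 hcoefE (negPf nT) l0 oppr0 mul0r add0r => E.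
by apply: (mulfI A0); rewrite -E mulrCA mulrA.
Qed.

Lemma half_derivation_qtorus : exists a c : K, forall m, m != 0 ->
  phi (X m) = a *: X m /\
  phi (D m) = (if m \in T then c else 0) *: X m + a *: D m.
Proof.
exists (phiDD 0 e), (phiDx 0 e) => m m0.
have eqd k : (m == k) = (k - m == 0) by rewrite subr_eq0 eq_sym.
have deg k : k = m + (k - m) by rewrite addrC subrK.
split; apply: qtorus_coefP => k k0.
- rewrite coefxZ coefx_X k0 andbT eqd {1}[k]deg -/(phixx _ _).
  have [->|d0] := eqVneq (k - m) 0; first by rewrite mulr1 phixx_diagonal.
  by rewrite mulr0 phixx_off_diagonal.
- by rewrite coefDZ coefD_X mulr0 [k]deg -/(phixD _ _) phixD_eq0.
- rewrite coefx_add !coefxZ coefx_X coefx_D k0 andbT eqd mulr0 addr0.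
  rewrite {1}[k]deg -/(phiDx _ _).
  have [->|d0] := eqVneq (k - m) 0; first by rewrite mulr1 phiDx_diagonal.
  by rewrite mulr0 phiDx_off_diagonal.
- rewrite coefD_add !coefDZ coefD_D coefD_X k0 andbT eqd mulr0 add0r.
  rewrite {1}[k]deg -/(phiDD _ _).
  have [->|d0] := eqVneq (k - m) 0; first by rewrite mulr1 phiDD_diagonal.
  by rewrite mulr0 phiDD_off_diagonal.
Qed.

End HalfDerivation.

Theorem theorem4p3 (R : realType) (t : nat) (q : R[i])
    (ht : (2 < t)%N) (hq : t.-primitive_root q)
    (phi : qtorus R[i] t -> qtorus R[i] t)
    (hphi : half_derivation (qtbr q) phi) :
  exists a c : R[i], forall m : Z2, m \in Gamma t ->
    phi (qtx R[i] t m) = a *: qtx R[i] t m /\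
    phi (qtD R[i] t m) =
      if m \in Gamma1 t then c *: qtx R[i] t m + a *: qtD R[i] t m
      else a *: qtD R[i] t m.
Proof.
have [a [c H]] := half_derivation_qtorus hq hphi.
exists a, c => m; rewrite GammaE => m0; have [-> ->] := H m m0.
have -> : (m \in Gamma1 t) = (m \in tZ2 t).
  by rewrite -[RHS]andbT -m0.
by split=> //; case: ifP => // _; rewrite scale0r add0r.
Qed.
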